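(* Let $p\ge 2$ and let $J$ be a periodic Jacobi operator on $\ell^2(\mathbb{Z})$ with period $p$, given by $(J\psi)_n=a_{n-1}\psi_{n-1}+b_n\psi_n+a_n\psi_{n+1}$, where $a_n>0$, $b_n\in\mathbb{R}$, $a_{n+p}=a_n$, $b_{n+p}=b_n$ for all $n$. Let $A:=(a_1\cdots a_p)^{1/p}$, and let $\sigma_n$ ($1\le n\le p$) and $\gamma_n$ ($1\le n\le p-1$) be the spectral bands and gaps of $J$. If $d>0$ satisfies $\min_{1\le n\le p-1}|\gamma_n|\ge d$, then $$\frac{1}{\log^+(d/A)}\ge\sum_{n=1}^{p}\frac{1}{\log^+\big(4d/|\sigma_n|\big)}.$$
   Context: $\log^+x:=\max\{\log x,0\}$, with the convention $1/0=+\infty$. Spectral structure: the spectrum of $J$ is $\sigma(J)=\{\lambda\in\mathbb{R}: |\Delta(\lambda)|\le 2\}$, where $\Delta(\lambda)=\operatorname{tr}\big(A_p(\lambda)A_{p-1}(\lambda)\cdots A_1(\lambda)\big)$ with $A_n(\lambda)=\begin{pmatrix}(\lambda-b_n)/a_n & -a_{n-1}/a_n\\ 1&0\end{pmatrix}$ (the discriminant, a real polynomial of degree $p$). It is a standard fact that this set is a union of $p$ closed intervals (bands) $\sigma_n=[\lambda_n^{\min},\lambda_n^{\max}]$, $1\le n\le p$, with $\lambda_n^{\min}<\lambda_n^{\max}\le\lambda_{n+1}^{\min}$ (bands may touch but do not overlap); on each band $\Delta$ is monotone and maps it onto $[-2,2]$. The spectral gaps are $\gamma_n=(\lambda_n^{\max},\lambda_{n+1}^{\min})$,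 $1\le n\le p-1$ (possibly empty). $|\cdot|$ denotes Lebesgue measure (length). *)

(* Defs.v *)
From HB Require Import structures.
From mathcomp Require Import all_boot all_order all_algebra.
From mathcomp Require Import all_classical all_reals all_analysis.
Set Implicit Arguments. Unset Strict Implicit. Unset Printing Implicit Defensive.
Import Order.TTheory GRing.Theory Num.Theory.
Local Open Scope ring_scope.

Definition transfer (R : realType) (a b : int -> R) (n : int) (lam : R) : 'M[R]_2 :=
  \matrix_(i < 2, j < 2)
    (if (i == 0%N :> nat) then
       (if (j == 0%N :> nat) then (lam - b n) / a n else - a (n - 1) / a n)
     else (if (j == 0%N :> nat) then 1 else 0)).

Fixpoint monodromy (R : realType) (a b : int -> R) (k : nat) (lam : R) : 'M[R]_2 :=
  match k with
  | O => 1%:M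
  | S k' => transfer a b (k'.+1)%:Z lam *m monodromy a b k' lam
  end.

Definition discriminant (R : realType) (a b : int -> R) (p : nat) (lam : R) : R :=
  \tr (monodromy a b p lam).

Definition logplus (R : realType) (x : R) : R := Num.max (ln x) 0.

Definition inv_logplus (R : realType) (x : R) : \bar R :=
  if logplus x == 0 then +oo%E else ((logplus x)^-1)%:E.

(* Main.v *)
Require Import Defs.
From HB Require Import structures.
From mathcomp Require Import all_boot all_order all_algebra.
From mathcomp Require Import all_classical all_reals all_analysis.
From mathcomp Require Import ring lra zify.
Import Order.TTheory GRing.Theory Num.Theory.
Local Open Scope ring_scope.

(** Fix a band [lo m, hi m] and put y = Delta (lo m). Every band contains a root of
    Delta - y, so these are all p roots and Delta (hi m) - y is their product
    formula with leading coefficient A^-p. The root in band m is lo m, the other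
    p - 1 are at distance at least d from hi m, and |Delta (hi m) - y| <= 4: hence
    A^-p d^(p-1) |sigma_m| <= 4, that is (d/A)^p <= 4d/|sigma_m|. For d > A
    each of the p summands is at most 1/(p log(d/A)). *)

Lemma monodromyS (R : realType) (a b : int -> R) (k : nat) (lam : R) (j : 'I_2) :
  (monodromy a b k.+1 lam 0 j =
     (lam - b k.+1%:Z) / a k.+1%:Z * monodromy a b k lam 0 j
     - a k%:Z / a k.+1%:Z * monodromy a b k lam 1 j) *
  (monodromy a b k.+1 lam 1 j = monodromy a b k lam 0 j).
Proof.
have -> : k%:Z = k.+1%:Z - 1 by lia.
rewrite [monodromy a b k.+1 lam]/= !mxE !big_ord_recl !big_ord0 !addr0.
have -> : lift ord0 ord0 = 1 :> 'I_2 by apply: val_inj.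
have -> : ord0 = 0 :> 'I_2 by apply: val_inj.
by rewrite !mxE /= mul1r mul0r addr0 !mulNr; split.
Qed.

Lemma size_cXaddC_mul_le {R : nzRingType} (c e : R) (q : {poly R}) (k : nat) :
  (size q <= k)%N -> (size ((c *: 'X + e%:P) * q)%R <= k.+1)%N.
Proof.
move=> qk; apply: leq_trans (size_polyMleq _ _) _.
have h : (size (c *: 'X + e%:P)%R <= 2)%N.
  apply: leq_trans (size_polyD _ _) _; rewrite geq_max.
  rewrite (leq_trans (size_scale_leq _ _)) ?size_polyX //.
  by rewrite (leq_trans (size_polyC_leq1 _)).
by lia.
Qed.

(** The recursion mixes the two entries of each column, so all four degrees are tracked together.
    Each step multiplies the top row by a linear factor in [lam], with slope the inverse of the new
    [a], and moves the old top row down. The [maxn] covers [k = 0], where the identity has a 1 in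
    the corner. *)
Lemma monodromy_poly (R : realType) (a b : int -> R) (k : nat) :
  exists q00 q01 q10 q11 : {poly R},
  [/\ forall lam,
        [/\ monodromy a b k lam 0 0 = q00.[lam],
            monodromy a b k lam 0 1 = q01.[lam],
            monodromy a b k lam 1 0 = q10.[lam] &
            monodromy a b k lam 1 1 = q11.[lam]],
      (size (q00 - (\prod_(i < k) a i.+1%:Z)^-1 *: 'X^k)%R <= k)%N,
      (size q01 <= k)%N, (size q10 <= k)%N & (size q11 <= maxn k 1)%N].
Proof.
elim: k => [|k [q00 [q01 [q10 [q11 [ev s00 s01 s10 s11]]]]]].
  exists 1, 0, 0, 1; split; rewrite ?size_poly0 ?size_poly1 //.
    by move=> lam; rewrite /= !mxE !hornerE.
  by rewrite big_ord0 invr1 scale1r expr0 subrr size_poly0.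
set a1 := a k.+1%:Z; set r := - (a k%:Z / a1).
pose l := a1^-1 *: 'X + (- (b k.+1%:Z / a1))%:P.
exists (l * q00 + r *: q10), (l * q01 + r *: q11), q00, q01.
have s00' : (size q00 <= k.+1)%N.
  rewrite -(subrK ((\prod_(i < k) a i.+1%:Z)^-1 *: 'X^k) q00).
  apply: leq_trans (size_polyD _ _) _; rewrite geq_max (leq_trans s00) //=.
  by rewrite (leq_trans (size_scale_leq _ _)) ?size_polyXn.
split=> //; last by lia.
- move=> lam; have [e00 e01 e10 e11] := ev lam.
  rewrite !monodromyS e00 e01 e10 e11 !hornerE; split=> //;
    by rewrite /r /a1; ring.
- rewrite big_ord_recr /= -/a1 invfM.
  set c := (\prod_(i < k) _)^-1 in s00 *.
  (* Only the ['X] part of [l] raises the degree, so it alone acts on [q00] minus its top term. The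
     constant part multiplies [q00] itself, whose size is already at most [k.+1]. *)
  have -> : l * q00 + r *: q10 - (c / a1) *: 'X^(k.+1) =
      (a1^-1 *: 'X + 0%:P) * (q00 - c *: 'X^k) + (- (b k.+1%:Z / a1)) *: q00
      + r *: q10.
    by rewrite /l exprS -!mul_polyC polyC0 polyCM; ring.
  apply: leq_trans (size_polyD _ _) _; rewrite geq_max; apply/andP; split.
    apply: leq_trans (size_polyD _ _) _; rewrite geq_max size_cXaddC_mul_le //=.
    exact: leq_trans (size_scale_leq _ _) _.
  by apply: leq_trans (size_scale_leq _ _) _; lia.
- apply: leq_trans (size_polyD _ _) _; rewrite geq_max size_cXaddC_mul_le //=.
  by apply: leq_trans (size_scale_leq _ _) _; lia.
Qed.

(** In the trace only the upper left entry reaches degree [p]: for [0 < p] the lower right one has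
    size at most [p]. *)
Lemma discriminant_poly (R : realType) (a b : int -> R) (p : nat) :
  (0 < p)%N -> (forall n, 0 < a n) ->
  exists q : {poly R},
  [/\ discriminant a b p =1 horner q, size q = p.+1 &
      lead_coef q = (\prod_(i < p) a i.+1%:Z)^-1].
Proof.
move=> p0 a0; have [q00 [q01 [q10 [q11 [ev s00 _ _ s11]]]]] :=
  monodromy_poly R a b p.
have c0 : (\prod_(i < p) a i.+1%:Z)^-1 != 0 by rewrite invr_eq0 gt_eqF ?prodr_gt0.
set c := _^-1 in s00 c0 *; have sc : size (c *: 'X^p) = p.+1.
  by rewrite size_scale // size_polyXn.
pose r := q00 - c *: 'X^p + q11.
have sr : (size r < size (c *: 'X^p)%R)%N.
  by rewrite sc ltnS (leq_trans (size_polyD _ _)) // geq_max s00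
    (leq_trans s11) // geq_max leqnn.
exists (c *: 'X^p + r); split.
- move=> lam; have [e00 e01 e10 e11] := ev lam.
  rewrite /discriminant /mxtrace !big_ord_recl big_ord0 addr0.
  rewrite [lift _ _](_ : _ = 1); last by apply/val_inj.
  by rewrite e00 e11 /r addrA subrKC hornerD.
- by rewrite size_polyDl.
- by rewrite lead_coefDl // lead_coefZ lead_coefXn mulr1.
Qed.

Lemma lead_coef_band_gap_le (R : realType) (q : {poly R}) (p : nat)
    (lo hi : nat -> R) (d : R) (m : 'I_p) :
  size q = p.+1 -> 0 < lead_coef q -> 0 < d ->
  (forall n, (n < p)%N -> lo n < hi n) ->
  (forall n, (n.+1 < p)%N -> d <= lo n.+1 - hi n) ->
  (forall n, (n < p)%N ->
     (forall x, lo n <= x <= hi n -> `|q.[x]| <= 2) /\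
     (forall y, `|y| <= 2 -> exists2 x, lo n <= x <= hi n & q.[x] = y)) ->
  lead_coef q * (hi m - lo m) * d ^+ p.-1 <= 4.
Proof.
move=> sq lc0 d0 lohi gap band.
have [bm _] := band m (ltn_ord m); have lm := lohi m (ltn_ord m).
(* Gaps separate neighbours only; for distant bands the widths and gaps in between are added up. *)
have sep i j : (i < j)%N -> (j < p)%N -> hi i + d <= lo j.
  elim: j => // j IH; rewrite ltnS leq_eqVlt => /predU1P[<-|ij] jp.
    by have := gap i jp; lra.
  have := IH ij (ltnW jp); have := gap j jp; have := lohi j (ltnW jp); lra.
have ylo : `|q.[lo m]| <= 2 by apply: bm; rewrite lexx ltW.
have yhi : `|q.[hi m]| <= 2 by apply: bm; rewrite lexx ltW.
(* The last clause pins the root in band [m] to its left end, so that its factor at [hi m] is the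
   full band width. *)
have /choice[f fP] : forall i : 'I_p, exists x,
    [/\ lo i <= x <= hi i, q.[x] = q.[lo m] & i = m -> x = lo m].
  move=> i; have [->|im] := eqVneq i m.
    by exists (lo m); rewrite lexx ltW.
  have [_ /(_ _ ylo)[x xi qx]] := band i (ltn_ord i).
  by exists x; split=> // /eqP; rewrite (negPf im).
have f_lt (i j : 'I_p) : (i < j)%N -> f i < f j.
  move=> ij; have [/andP[_ fi] _ _] := fP i; have [/andP[fj _] _ _] := fP j.
  have := sep _ _ ij (ltn_ord j); lra.
(* Distinct roots, as many as the degree, force the complete factorisation of [q - y%:P]. *)
have f_inj : injective f.
  move=> i j fij; apply/val_inj; case: (ltngtP i j) => // /f_lt;
    by rewrite fij ltxx.
set y := q.[lo m] in ylo fP.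
have sy : (size (- y%:P)%R < size q)%N.
  rewrite size_polyN sq (leq_ltn_trans (size_polyC_leq1 _)) // ltnS.
  exact: leq_ltn_trans (ltn_ord m).
have szq : size (q - y%:P)%R = (size (map f (enum 'I_p))).+1.
  by rewrite size_polyDl // sq size_map size_enum_ord.
have qf : all (root (q - y%:P)) (map f (enum 'I_p)).
  apply/allP => _ /mapP[i _ ->]; have [_ qi _] := fP i.
  by rewrite /root !hornerE qi subrr.
have uf : uniq_roots (map f (enum 'I_p)).
  by rewrite uniq_rootsE map_inj_uniq ?enum_uniq.
have := all_roots_prod_XsubC szq qf uf.
rewrite lead_coefDl // big_map big_enum /= => /(congr1 (fun r => `|r.[hi m]|)).
rewrite !hornerE horner_prod normrM normr_prod (gtr0_norm lc0) => E.
have : lead_coef q * \prod_i `|('X - (f i)%:P).[hi m]| <= 4.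
  rewrite -E; apply: le_trans (ler_normB _ _) _; lra.
apply: le_trans; rewrite -mulrA ler_wpM2l ?(ltW lc0) //.
have [_ _ fm] := fP m.
(* The factor of band [m] is split off; the [p.-1] others are each at least [d]. *)
rewrite (bigD1 m) //= !hornerE fm // gtr0_norm ?subr_gt0 //
  ler_wpM2l ?subr_ge0 ?(ltW lm) //.
have -> : d ^+ p.-1 = \prod_(i < p | i != m) d.
  by rewrite prodr_const cardC1 card_ord.
apply: ler_prod => i im; rewrite (ltW d0) /= !hornerE.
have [/andP[fi1 fi2] _ _] := fP i.
have : val i != m by [].
rewrite neq_ltn => /orP[im'|mi].
  by have := sep _ _ im' (ltn_ord m); have := ler_norm (hi m - f i); lra.
by have := sep _ _ mi (ltn_ord i); have := ler_norm (f i - hi m);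
  rewrite distrC; lra.
Qed.

(** Positivity of [ln x] passes to [ln y], which keeps [inv_logplus y] off the value [+oo]. *)
Lemma inv_logplus_le (R : realType) (x y : R) :
  0 < ln x -> ln x <= ln y -> (inv_logplus y <= ((ln x)^-1)%:E)%E.
Proof.
move=> x0 xy; have y0 := lt_le_trans x0 xy.
by rewrite /inv_logplus /logplus max_l ?(ltW y0) // gt_eqF // lee_fin lef_pV2.
Qed.

(* Bands are indexed 0 <= n < p: band n is sigma_{n+1} = [lo n, hi n];
   gap n (n+1 < p) is gamma_{n+1} = (hi n, lo (n+1)). *)
Theorem theorem1p3 (R : realType) (p : nat) (a b : int -> R)
  (lo hi : nat -> R) (d : R) :
  (2 <= p)%N ->
  (forall n : int, 0 < a n) ->
  (forall n : int, a (n + p%:Z) = a n) ->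
  (forall n : int, b (n + p%:Z) = b n) ->
  (* band structure of sigma(J) = {lam : |Delta(lam)| <= 2} *)
  (forall n : nat, (n < p)%N -> lo n < hi n) ->
  (forall n : nat, (n.+1 < p)%N -> hi n <= lo n.+1) ->
  (forall lam : R, `|discriminant a b p lam| <= 2 <->
     exists2 n : nat, (n < p)%N & lo n <= lam <= hi n) ->
  (forall n : nat, (n < p)%N ->
     (forall x y : R, lo n <= x -> x < y -> y <= hi n ->
        discriminant a b p x < discriminant a b p y)
     \/
     (forall x y : R, lo n <= x -> x < y -> y <= hi n ->
        discriminant a b p y < discriminant a b p x)) ->
  (forall n : nat, (n < p)%N ->
     (forall x : R, lo n <= x <= hi n -> `|discriminant a b p x| <= 2) /\
     (forall y : R, `|y| <= 2 -> exists2 x : R, lo n <= x <= hi n &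
        discriminant a b p x = y)) ->
  0 < d ->
  (forall n : nat, (n.+1 < p)%N -> d <= lo n.+1 - hi n) ->
  (inv_logplus (d / powR (\prod_(i < p) a (i.+1)%:Z) (p%:R^-1)) >=
   \sum_(n < p) inv_logplus (4 * d / (hi n - lo n)))%E.
Proof.
move=> p2 a0 _ _ lohi _ _ _ band d0 gap.
have p0 : (0 < p)%N by lia.
have [q [Eq sq lq]] := discriminant_poly R a b p p0 a0.
set P := \prod_(i < p) _ in lq *.
have P0 : 0 < P by apply: prodr_gt0.
set x := d / _.
have x0 : 0 < x by rewrite divr_gt0 ?powR_gt0.
rewrite [inv_logplus x]/inv_logplus /logplus.
(* For [d] at most A the left side is [+oo]. *)
have [lx|lx] := leP (ln x) 0; first by rewrite eqxx leey.
rewrite gt_eqF //.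
have lnxp : ln (d ^+ p / P) = p%:R * ln x.
  rewrite /x !ln_div ?posrE ?exprn_gt0 ?powR_gt0 // lnXn // ln_powR mulrBr mulrA.
  by rewrite divff ?pnatr_eq0 -?lt0n // mul1r mulr_natl.
have bound (m : 'I_p) :
    (inv_logplus (4 * d / (hi m - lo m)) <= ((p%:R * ln x)^-1)%:E)%E.
  have lm : 0 < hi m - lo m by rewrite subr_gt0 lohi.
  rewrite -lnxp; apply: inv_logplus_le.
    by rewrite lnxp mulr_gt0 ?ltr0n.
  rewrite ler_ln ?posrE ?divr_gt0 ?exprn_gt0 ?mulr_gt0 //.
  have lc0 : 0 < lead_coef q by rewrite lq invr_gt0.
  have band' n : (n < p)%N ->
      (forall x, lo n <= x <= hi n -> `|q.[x]| <= 2) /\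
      (forall y, `|y| <= 2 -> exists2 x, lo n <= x <= hi n & q.[x] = y).
    move=> np; have [b1 b2] := band n np.
    split=> [z /b1|y /b2[z zn <-]]; first by rewrite Eq.
    by exists z => //; rewrite Eq.
  (* Multiplying the bound by [d] completes [d ^+ p.-1] to [d ^+ p]. *)
  have := @lead_coef_band_gap_le R q p lo hi d m sq lc0 d0 lohi gap band'.
  rewrite lq ler_pdivlMr // -(ler_pM2r d0) => /(le_trans _); apply.
  by rewrite -{1}(prednK p0) exprS le_eqVlt; apply/orP; left; apply/eqP; ring.
apply: (@le_trans _ _ (\sum_(m < p) ((p%:R * ln x)^-1)%:E)%E).
  by apply: lee_sum => m _; apply: bound.
rewrite sumEFin lee_fin sumr_const card_ord -[_ *+ p]mulr_natl invfM mulrA.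
by rewrite divff ?pnatr_eq0 -?lt0n // mul1r.
Qed.
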